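(* Suppose that $f:\mathbb{R}^n\to\mathbb{R}$ is differentiable with $L_f$-Lipschitz continuous gradient ($L_f>0$), that $g:\mathbb{R}^n\to\overline{\mathbb{R}}$ is proper, lower semicontinuous and convex, and that $\operatorname{argmin}\varphi\neq\emptyset$ where $\varphi=f+g$. Let $(\hat x^k)_{k\in\mathbb{N}}$ be a sequence generated by the PANOC-lite algorithm (described in the context). Then: (i) $\sum_{k\in\mathbb{N}}\|R^{\rm nat}_\gamma(\hat x^k)\|^2<\infty$; (ii) any limit point $\hat x^\star$ of $(\hat x^k)_{k\in\mathbb{N}}$ satisfies $R^{\rm nat}_\gamma(\hat x^\star)=0$; (iii) if $\varphi$ is level bounded, then $(\hat x^k)_{k\in\mathbb{N}}$ is bounded.
   Context: $\overline{\mathbb{R}}=\mathbb{R}\cup\{+\infty\}$, $\mathbb{N}=\{0,1,2,\dots\}$, $\|\cdot\|$ is the Euclidean norm. $\operatorname{prox}_{\gamma g}(x)=\operatorname{argmin}_u\{g(u)+\frac1{2\gamma}\|u-x\|^2\}$, $T_\gamma(x)=\operatorname{prox}_{\gamma g}(x-\gamma\nabla f(x))$, and $R^{\rm nat}_\gamma(x)=\gamma^{-1}(x-T_\gamma(x))$. $\varphi$ is level bounded if $\{x\mid\varphi(x)\le\alpha\}$ is bounded for every $\alpha\in\mathbb{R}$. A limit point of a sequence is the limit of some subsequence. PANOC-lite algorithm. Parameters: $x^0\in\mathbb{R}^n$, $\gamma\in(0,2/L_f)$, $\beta\in(0,1)$, $\sigma\in\bigl(0,\gamma\frac{2-\gamma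 L_f}{2}\bigr)$. Initialize $\hat x^0=\operatorname{prox}_{\gamma g}(x^0)$. For $k=0,1,2,\dots$: set $\bar x^k=\hat x^k-\gamma\nabla f(\hat x^k)$ and $R^{\rm nat}_\gamma(\hat x^k)=\gamma^{-1}(\hat x^k-\operatorname{prox}_{\gamma g}(\bar x^k))$; select an arbitrary direction $\bar d^k\in\mathbb{R}^n$ and let $x^{k+1}=\bar x^k+\tau_k\bar d^k$, $\hat x^{k+1}=\operatorname{prox}_{\gamma g}(x^{k+1})$, where $\tau_k$ is the largest element of $\{\beta^i\mid i\in\mathbb{N}\}$ such that the linesearch condition $\varphi(\hat x^{k+1})-\varphi(\hat x^k)\le-\sigma\|R^{\rm nat}_\gamma(\hat x^k)\|^2$ holds. ''Generated by the algorithm'' means an infinite sequence of iterates satisfying these relations for all $k\in\mathbb{N}$. *)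

(* Defs.v *)
(* MathComp-Analysis; R^n is 'rV[R]_n over an arbitrary R : realType. *)
From HB Require Import structures.
From mathcomp Require Export all_boot all_order all_algebra.
From mathcomp Require Export all_classical all_reals all_analysis.

Set Implicit Arguments.
Unset Strict Implicit.
Unset Printing Implicit Defensive.

Import Order.TTheory GRing.Theory Num.Theory.
Import numFieldNormedType.Exports.

Local Open Scope classical_set_scope.
Local Open Scope ring_scope.

(* The library norm `|x| on 'rV[R]_n is the sup norm. It induces the same
   topology, bounded sets and differentiable functions as the Euclidean norm,
   so the library notions are used for those; enorm is used wherever the value
   of the norm matters. *)
Definition enorm (R : realType) (n : nat) (x : 'rV[R]_n) : R :=
  Num.sqrt (\sum_(i < n) x ord0 i ^+ 2).

Definition grad (R : realType) (n : nat) (f : 'rV[R]_n -> R) (x : 'rV[R]_n) :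
    'rV[R]_n :=
  \row_(i < n) 'D_(delta_mx ord0 i) f x.

(* Functions into R U {+oo} are functions into \bar R; the exclusion of -oo is
   part of properness. *)
Definition proper_efun (R : realType) (T : Type) (g : T -> \bar R) : Prop :=
  (forall x, (-oo < g x)%E) /\ (exists x, (g x < +oo)%E).

Definition convex_efun (R : realType) (n : nat) (g : 'rV[R]_n -> \bar R) :
    Prop :=
  forall (x y : 'rV[R]_n) (t : R), 0 <= t -> t <= 1 ->
    (g (t *: x + (1 - t) *: y)%R <= t%:E * g x + (1 - t)%:E * g y)%E.

Definition argmin (R : realType) (T : Type) (F : T -> \bar R) : set T :=
  [set x | forall y, (F x <= F y)%E].

Definition level_bounded (R : realType) (n : nat) (F : 'rV[R]_n -> \bar R) :
    Prop :=
  forall alpha : R, bounded_set [set x : 'rV[R]_n | (F x <= alpha%:E)%E].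

(* [get] returns a chosen element of the set of minimizers, which is a singleton
   when g is proper, lower semicontinuous and convex and 0 < gamma. *)
Definition prox (R : realType) (n : nat) (gamma : R) (g : 'rV[R]_n -> \bar R)
    (x : 'rV[R]_n) : 'rV[R]_n :=
  get (argmin (fun u : 'rV[R]_n =>
         (g u + ((2 * gamma)^-1 * enorm (u - x) ^+ 2)%:E)%E)).

Definition fwd (R : realType) (n : nat) (gamma : R) (f : 'rV[R]_n -> R)
    (x : 'rV[R]_n) : 'rV[R]_n :=
  x - gamma *: grad f x.

Definition fwd_bwd (R : realType) (n : nat) (gamma : R) (f : 'rV[R]_n -> R)
    (g : 'rV[R]_n -> \bar R) (x : 'rV[R]_n) : 'rV[R]_n :=
  prox gamma g (fwd gamma f x).

Definition natres (R : realType) (n : nat) (gamma : R) (f : 'rV[R]_n -> R)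
    (g : 'rV[R]_n -> \bar R) (x : 'rV[R]_n) : 'rV[R]_n :=
  gamma^-1 *: (x - fwd_bwd gamma f g x).

Definition cost (R : realType) (n : nat) (f : 'rV[R]_n -> R)
    (g : 'rV[R]_n -> \bar R) (x : 'rV[R]_n) : \bar R :=
  ((f x)%:E + g x)%E.

(* The stepsizes beta ^+ i accepted by the linesearch at xhat along d. Both cost
   values are finite, as xhat and the trial point are values of prox. *)
Definition accepted (R : realType) (n : nat) (f : 'rV[R]_n -> R)
    (g : 'rV[R]_n -> \bar R) (gamma beta sigma : R) (xhat d : 'rV[R]_n) :
    set R :=
  [set t : R | (exists i : nat, t = beta ^+ i) /\
    (cost f g (prox gamma g (fwd gamma f xhat + t *: d)%R) - cost f g xhat
       <= (- sigma * enorm (natres gamma f g xhat) ^+ 2)%:E)%E].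

(* An infinite run of the algorithm started at x 0, with arbitrary directions
   d; tau k is the largest accepted stepsize. *)
Record panoc_lite (R : realType) (n : nat) (f : 'rV[R]_n -> R)
    (g : 'rV[R]_n -> \bar R) (gamma beta sigma : R)
    (x xbar xhat d : nat -> 'rV[R]_n) (tau : nat -> R) : Prop := PanocLite {
  panoc_xhat : forall k, xhat k = prox gamma g (x k);
  panoc_xbar : forall k, xbar k = fwd gamma f (xhat k);
  panoc_step : forall k, x k.+1 = xbar k + tau k *: d k;
  panoc_tau_accepted : forall k,
    accepted f g gamma beta sigma (xhat k) (d k) (tau k);
  panoc_tau_largest : forall k t,
    accepted f g gamma beta sigma (xhat k) (d k) t -> t <= tau k
}.

Definition limit_of_subseq (T : topologicalType) (u : nat -> T) (l : T) :
    Prop :=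
  exists s : nat -> nat, increasing_seq s /\ (u \o s) @ \oo --> l.

(* Main.v *)
Require Import Defs.
From mathcomp Require Import ring lra.
Import Order.TTheory GRing.Theory Num.Theory.
Import numFieldNormedType.Exports.
Local Open Scope classical_set_scope.
Local Open Scope ring_scope.

Set Implicit Arguments.
Unset Strict Implicit.
Unset Printing Implicit Defensive.

(** The linesearch condition is a sufficient decrease of the cost: summing it
    over the iterations telescopes, and since the cost is bounded below by its
    minimum, the squared residuals are summable and the costs never exceed the
    initial one. This gives (i), and (iii) because all iterates lie in one
    sublevel set. For (ii), the residuals tend to 0 and the residual map is
    Lipschitz, so it vanishes at every limit point.

    What has to be built is the proximal map: its minimization problem must
    have a solution (otherwise the iterates could have infinite cost, and the
    telescoping would be meaningless), and it must be nonexpansive (for the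
    Lipschitz property of the residual). Both follow from the strong convexity
    of the proximal objective. A lower semicontinuous strongly convex function
    attains its minimum ([strongly_convex_argmin]): it is bounded below on a
    unit ball by compactness, and strong convexity along rays propagates this
    to coercivity. It also grows quadratically away from its minimizer
    ([strongly_convex_growth]); applying this growth at two proximal points and
    adding yields nonexpansiveness ([prox_nonexpansive]). *)

(** * The squared Euclidean norm *)

Section Euclid.
Variables (R : realType) (n : nat).
Implicit Types x y u v a : 'rV[R]_n.

Lemma enorm_sqr x : enorm x ^+ 2 = \sum_(i < n) x ord0 i ^+ 2.
Proof. by rewrite sqr_sqrtr// sumr_ge0// => i _; exact: sqr_ge0. Qed.

Lemma enormZ_sqr (t : R) x : enorm (t *: x) ^+ 2 = t ^+ 2 * enorm x ^+ 2.
Proof.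
by rewrite !enorm_sqr mulr_sumr; apply: eq_bigr => i _; rewrite mxE exprMn.
Qed.

Lemma enormN_sqr x : enorm (- x) ^+ 2 = enorm x ^+ 2.
Proof. by rewrite -scaleN1r enormZ_sqr sqrrN expr1n mul1r. Qed.

Lemma enorm_distC_sqr x y : enorm (x - y) ^+ 2 = enorm (y - x) ^+ 2.
Proof. by rewrite -opprB enormN_sqr. Qed.

Lemma enormD_sqr_le x y :
  enorm (x + y) ^+ 2 <= 2 * enorm x ^+ 2 + 2 * enorm y ^+ 2.
Proof.
rewrite !enorm_sqr !mulr_sumr -big_split/=; apply: ler_sum => i _.
by rewrite mxE; have := sqr_ge0 (x ord0 i - y ord0 i); lra.
Qed.

Lemma enorm_convex_comb (t : R) u v a :
  enorm (t *: u + (1 - t) *: v - a) ^+ 2 =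
  t * enorm (u - a) ^+ 2 + (1 - t) * enorm (v - a) ^+ 2
    - t * (1 - t) * enorm (u - v) ^+ 2.
Proof.
rewrite !enorm_sqr !mulr_sumr -sumrN -!big_split/=.
by apply: eq_bigr => i _; rewrite !mxE; ring.
Qed.

(** The left-hand side is twice the inner product of [u - v] and [a - b], so
    this is Young's inequality. In this form it combines with the two quadratic
    growth inequalities of the proximal map without any inner product. *)
Lemma enorm_four_points u v a b :
  enorm (v - a) ^+ 2 + enorm (u - b) ^+ 2
    - enorm (u - a) ^+ 2 - enorm (v - b) ^+ 2 <=
  enorm (u - v) ^+ 2 + enorm (a - b) ^+ 2.
Proof.
rewrite !enorm_sqr -!sumrN -!big_split/=; apply: ler_sum => i _; rewrite !mxE.
by have := sqr_ge0 ((u ord0 i - v ord0 i) - (a ord0 i - b ord0 i)); lra.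
Qed.

Lemma enorm_sqr_eq0 x : enorm x ^+ 2 <= 0 -> x = 0.
Proof.
move=> x0; have : \sum_(i < n) x ord0 i ^+ 2 == 0.
  by rewrite -enorm_sqr eq_le x0 sqr_ge0.
rewrite psumr_eq0; last by move=> i _; exact: sqr_ge0.
move=> /allP xi0; apply/rowP => i; rewrite mxE; apply/eqP.
by rewrite -sqrf_eq0; apply: xi0; rewrite mem_index_enum.
Qed.

(** Compactness and the topology are those of the sup norm; this comparison
    transfers Euclidean strong convexity to sup-norm balls. *)
Lemma normr_le_enorm x : `|x| ^+ 2 <= enorm x ^+ 2.
Proof.
have [->|x0] := eqVneq `|x| 0; first by rewrite expr0n sqr_ge0.
have [[i j] /= xE] := mx_norm_neq0 x0; have {xE}-> : `|x| = `|x i j| by [].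
rewrite real_normK ?num_real// (ord1 i) enorm_sqr (bigD1 j)//= lerDl.
by apply: sumr_ge0 => k _; exact: sqr_ge0.
Qed.

Lemma continuous_enorm_sqr a : continuous (fun u => enorm (u - a) ^+ 2).
Proof.
pose F i u := (u ord0 i - a ord0 i) * (u ord0 i - a ord0 i).
have -> : (fun u => enorm (u - a) ^+ 2) = \sum_(i < n) F i.
  apply/funext => u; rewrite enorm_sqr fct_sumE; apply: eq_bigr => i _.
  by rewrite !mxE expr2.
apply: (big_ind (fun q : 'rV[R]_n -> R => continuous q)).
- exact: cst_continuous.
- by move=> p q pc qc u; exact: (continuousD (pc u) (qc u)).
- move=> i _ u.
  have Fi : continuous (fun v : 'rV[R]_n => v ord0 i - a ord0 i).
    move=> v; apply: continuousB; first exact: coord_continuous.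
    exact: cst_continuous.
  exact: (continuousM (Fi u) (Fi u)).
Qed.

End Euclid.

(** * Lower semicontinuous functions *)

Lemma ereal_le_fin_between (R : realType) (y z : \bar R) :
  (y < z)%E -> exists2 a : R, (y <= a%:E)%E & (a%:E < z)%E.
Proof.
case: y => [y||]; last 2 first.
- by rewrite ltNge leey.
- case: z => [z||]// _; last by exists 0; rewrite ?leNye ?ltry.
  by exists (z - 1); rewrite ?leNye// lte_fin ltrBlDr ltrDl.
- by move=> yz; exists y.
Qed.

(** The sublevel sets of [h] on [K], taken at the values of [h], form a filter
    base. A cluster point of that filter is a minimizer, since lower
    semicontinuity makes each sublevel set closed. *)
Lemma lsc_compact_min (R : realType) (T : topologicalType) (h : T -> \bar R)
    (K : set T) :
  lower_semicontinuous h -> compact K -> K !=set0 ->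
  exists2 p, K p & forall u, K u -> (h p <= h u)%E.
Proof.
move=> hlsc cK [v0 Kv0].
pose B v := K `&` [set u | (h u <= h v)%E].
have FB : Filter (filter_from K B).
  apply: filter_from_filter; first by exists v0.
  move=> v w Kv Kw; have [vw|wv] := leP (h v) (h w).
    by exists v => // u [Ku /= uv]; split; split => //=; exact: le_trans uv vw.
  exists w => // u [Ku /= uw]; split; split => //=.
  exact: le_trans uw (ltW wv).
have PB : ProperFilter (filter_from K B).
  by apply: filter_from_proper => v Kv; exists v; split => /=.
have [|p [Kp clp]] := cK _ PB; first by exists v0 => // u [].
exists p => // v Kv; rewrite leNgt; apply/negP => vp.
have [a va ap] := ereal_le_fin_between vp.
have [V Vp Va] := hlsc _ _ ap.
have [|u [[_ /= uv] /Va]] := clp (B v) V _ Vp; first by exists v.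
by rewrite ltNge (le_trans uv va).
Qed.

(** Excluding [-oo] makes it possible to split a strict lower bound of the sum
    at [u] into a real strict lower bound for each of the two terms. *)
Lemma lscD_continuous (R : realType) (T : topologicalType) (g : T -> \bar R)
    (q : T -> R) :
  (forall u, (-oo < g u)%E) ->
  lower_semicontinuous g -> continuous q ->
  lower_semicontinuous (fun u => (g u + (q u)%:E)%E).
Proof.
move=> g_gtNy glsc qc u a agq.
have [b ab bg] : exists2 b : R, a - q u < b & (b%:E < g u)%E.
  have := g_gtNy u; case: (g u) agq => [r||]// agq _; last first.
    by exists (a - q u + 1); rewrite ?ltry// ltrDl.
  rewrite -EFinD lte_fin in agq.
  by exists ((a - q u + r) / 2); rewrite ?lte_fin; lra.
have [V Vu Vb] := glsc _ _ bg.
have qu : nbhs u [set w | a - b < q w].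
  by apply: (cvgr_gt (q u)); [exact: qc|lra].
exists (V `&` [set w | a - b < q w]); first exact: filterI.
move=> w [/Vb bw /= qw]; apply: le_lt_trans (_ : (b%:E + (a - b)%:E < _)%E).
  by rewrite -EFinD lee_fin; lra.
by apply: lteD => //; rewrite lte_fin.
Qed.

(** * Strongly convex functions *)

(** The inequality is asked only where both values are real, which for functions
    that avoid [-oo] is the only case with content and keeps the right-hand side
    in the reals. The modulus is normalized so that [c * enorm _ ^+ 2] has
    modulus [c]. *)
Definition strongly_convex (R : realType) (n : nat) (c : R)
    (h : 'rV[R]_n -> \bar R) : Prop :=
  forall (u v : 'rV[R]_n) (a b t : R), 0 <= t -> t <= 1 ->
    h u = a%:E -> h v = b%:E ->
    (h (t *: u + (1 - t) *: v)%R <=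
      (t * a + (1 - t) * b - c * (t * (1 - t)) * enorm (u - v) ^+ 2)%:E)%E.

Lemma compact_norm_ball (R : realType) (n : nat) (a : 'rV[R]_n) (r : R) :
  compact [set u | `|a - u| <= r].
Proof.
apply: bounded_closed_compact; last exact: closed_closed_ball_.
exists (`|a| + r); split; first exact: num_real.
move=> M ltM u /= ur.
rewrite -[u](subKr a) (le_trans (ler_normB _ _))//.
by rewrite (le_trans _ (ltW ltM))// lerD2l.
Qed.

(** Distances here are in the sup norm. Let [m] be the minimum of [h] on the
    unit ball around a point [x0] with [h x0 = h0] real. For [u] at distance
    [r > 1] from [x0], the point [w] of the segment from [x0] to [u] at
    distance 1 satisfies [m <= h w], and strong convexity bounds [h w] from
    above; solving for [h u] gives [h u >= h0 + r * (m - h0 + c * (r - 1))],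
    which is at least [h0] as soon as [r >= 1 + (h0 - m) / c]. Hence a minimizer
    over the ball of that radius is a global one. *)
Lemma strongly_convex_argmin (R : realType) (n : nat) (c : R)
    (h : 'rV[R]_n -> \bar R) :
  0 < c -> lower_semicontinuous h -> proper_efun h -> strongly_convex c h ->
  argmin h !=set0.
Proof.
move=> c0 hlsc [hNy [x0 hx0]] hsc.
have [h0 h0E] : exists h0, h x0 = h0%:E.
  by move: hx0 (hNy x0); case: (h x0) => // r _ _; exists r.
have ballx0 (r : R) : 0 <= r -> `|x0 - x0| <= r by rewrite subrr normr0.
have [|w0 /= _ w0min] := lsc_compact_min hlsc (@compact_norm_ball _ _ x0 1).
  by exists x0; apply: ballx0.
have w0x0 : (h w0 <= h0%:E)%E by rewrite -h0E; apply: w0min; exact: ballx0.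
have [m mE] : exists m, h w0 = m%:E.
  by move: w0x0 (hNy w0); case: (h w0) => // r _ _; exists r.
move: w0x0; rewrite mE lee_fin => mh0.
pose rho := 1 + (h0 - m) / c.
have rho1 : 1 <= rho by rewrite lerDl divr_ge0 ?subr_ge0// ltW.
have x0K : `|x0 - x0| <= rho by apply: ballx0; lra.
have [|p /= _ pmin] := lsc_compact_min hlsc (@compact_norm_ball _ _ x0 rho).
  by exists x0.
exists p => u; have [/pmin//|rhor] := leP `|x0 - u| rho.
apply: (le_trans (pmin _ x0K)).
have := hNy u; case huE : (h u) => [a||]// _; last by rewrite leey.
rewrite h0E lee_fin.
move: rhor; rewrite distrC; set r := `|u - x0| => rhor.
have r1 : 1 < r by lra.
have ri0 : 0 <= r^-1 by rewrite invr_ge0; lra.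
have ri1 : r^-1 <= 1 by rewrite invf_le1; lra.
have := hsc _ _ _ _ _ ri0 ri1 huE h0E.
set w := (X in h X) => hw.
have wK : `|x0 - w| <= 1.
  have -> : x0 - w = r^-1 *: (x0 - u).
    by apply/rowP => i; rewrite !mxE; ring.
  by rewrite normrZ ger0_norm// distrC -/r mulVf//; lra.
have := le_trans (w0min _ wK) hw; rewrite mE lee_fin => mle.
have E := normr_le_enorm (u - x0); rewrite -/r in E.
have rrho : h0 - m <= c * (r - 1).
  have : (h0 - m) / c < r - 1 by rewrite /rho in rhor; lra.
  by rewrite ltr_pdivrMr// => /ltW; rewrite mulrC.
have rV : r * r^-1 = 1 by rewrite divff//; lra.
have {}mle : r * m <= a + (r - 1) * h0 - c * (1 - r^-1) * enorm (u - x0) ^+ 2.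
  rewrite -(ler_pM2l (_ : 0 < r)) in mle; last lra.
  apply: le_trans mle _; rewrite le_eqVlt; apply/orP; left; apply/eqP.
  transitivity ((r * r^-1) * a + (r - r * r^-1) * h0
    - c * ((r * r^-1) * (1 - r^-1)) * enorm (u - x0) ^+ 2); first by ring.
  by rewrite rV; ring.
have cE : c * (1 - r^-1) * r ^+ 2 <= c * (1 - r^-1) * enorm (u - x0) ^+ 2.
  by apply: ler_wpM2l => //; apply: mulr_ge0; lra.
have cr : c * (1 - r^-1) * r ^+ 2 = r * (c * (r - 1)).
  transitivity (c * (r - r * r^-1) * r); first by ring.
  by rewrite rV; ring.
have : r * (h0 - m) <= r * (c * (r - 1)) by rewrite ler_pM2l//; lra.
lra.
Qed.

(** Comparing [p] with [t *: u + (1 - t) *: p] and dividing by [t] gives the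
    claim with [c * (1 - t)] in place of [c]; then [t] tends to 0. *)
Lemma strongly_convex_growth (R : realType) (n : nat) (c : R)
    (h : 'rV[R]_n -> \bar R) (p u : 'rV[R]_n) (a b : R) :
  0 <= c -> strongly_convex c h -> argmin h p -> h p = a%:E -> h u = b%:E ->
  a + c * enorm (u - p) ^+ 2 <= b.
Proof.
move=> c0 hsc pmin hp hu; set E := enorm _ ^+ 2.
have E0 : 0 <= E by exact: sqr_ge0.
apply/ler_addgt0Pl => e e0.
(* Any t in (0, 1] with t * (c * E) <= e would do. *)
pose t := e / (e + c * E + 1).
have cE0 : 0 <= c * E by exact: mulr_ge0.
have t0 : 0 < t by rewrite divr_gt0//; lra.
have t1 : t <= 1 by rewrite ler_pdivrMr; lra.
have tE : t * (c * E) <= e.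
  rewrite mulrAC ler_pdivrMr; last lra.
  by apply: ler_wpM2l; lra.
have := le_trans (pmin _) (hsc _ _ _ _ _ (ltW t0) t1 hu hp).
rewrite hp lee_fin -/E => pt.
have : t * (a + c * (1 - t) * E) <= t * b by lra.
rewrite ler_pM2l//; lra.
Qed.

(** * The proximal map *)

Section Prox.
Variables (R : realType) (n : nat) (g : 'rV[R]_n -> \bar R) (gamma : R).
Hypotheses (g_proper : proper_efun g) (g_lsc : lower_semicontinuous g).
Hypotheses (g_convex : convex_efun g) (gamma_gt0 : 0 < gamma).
Implicit Types a b u : 'rV[R]_n.

Let c := (2 * gamma)^-1.
Let prox_obj a u : \bar R := (g u + (c * enorm (u - a) ^+ 2)%:E)%E.

Let c_gt0 : 0 < c.
Proof. by rewrite invr_gt0 mulr_gt0. Qed.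

Lemma prox_obj_fin a u (r : R) :
  prox_obj a u = r%:E -> g u = (r - c * enorm (u - a) ^+ 2)%:E.
Proof.
rewrite /prox_obj; case: (g u) => [s||]//= [<-].
by rewrite addrK.
Qed.

Lemma prox_obj_strongly_convex a : strongly_convex c (prox_obj a).
Proof.
move=> u v r s t t0 t1 /prox_obj_fin gu /prox_obj_fin gv.
have := g_convex u v t0 t1; rewrite gu gv -!EFinM -EFinD => guv.
rewrite /prox_obj; apply: le_trans (leeD2r _ guv) _.
by rewrite -EFinD lee_fin enorm_convex_comb le_eqVlt; apply/orP; left;
  apply/eqP; ring.
Qed.

Lemma prox_obj_proper a : proper_efun (prox_obj a).
Proof.
case: g_proper => gNy [u gu]; split=> [v|].
  by rewrite /prox_obj; have := gNy v; case: (g v) => // r _; rewrite ltNyr.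
by exists u; rewrite /prox_obj lte_add_pinfty// ltry.
Qed.

(** This is where [get] in the definition of [prox] is shown not to return its
    default value. *)
Lemma prox_argmin a : argmin (prox_obj a) (prox gamma g a).
Proof.
suff : argmin (prox_obj a) !=set0 by move=> /getPex.
apply: (strongly_convex_argmin c_gt0).
- apply: lscD_continuous => //; first exact: g_proper.1.
  move=> u; have Ec := @continuous_enorm_sqr R n a u.
  exact: (continuousM (@cst_continuous _ _ c u) Ec).
- exact: prox_obj_proper.
- exact: prox_obj_strongly_convex.
Qed.

Lemma prox_fin a : exists r, g (prox gamma g a) = r%:E.
Proof.
have [_ [u gu]] := prox_obj_proper a.
have := le_lt_trans (prox_argmin a u) gu.
have := (prox_obj_proper a).1 (prox gamma g a).
case E : (prox_obj _ _) => [r||]// _ _.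
by eexists; exact: prox_obj_fin E.
Qed.

Lemma prox_growth a b p q : p = prox gamma g a -> q = prox gamma g b ->
  fine (g p) + c * enorm (p - a) ^+ 2 + c * enorm (q - p) ^+ 2 <=
  fine (g q) + c * enorm (q - a) ^+ 2.
Proof.
move=> -> ->; have [r gp] := prox_fin a; have [s gq] := prox_fin b.
apply: (@strongly_convex_growth _ _ _ (prox_obj a) _ _) (ltW c_gt0) _ _ _ _.
- exact: prox_obj_strongly_convex.
- exact: prox_argmin.
- by rewrite /prox_obj gp.
- by rewrite /prox_obj gq.
Qed.

(** Adding the growth inequality at [p] with competitor [q] to the one at [q]
    with competitor [p] cancels the values of [g] and leaves
    [2 * enorm (p - q) ^+ 2] below the four-point expression. *)
Lemma prox_nonexpansive a b :
  enorm (prox gamma g a - prox gamma g b) ^+ 2 <= enorm (a - b) ^+ 2.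
Proof.
set p := prox _ _ a; set q := prox _ _ b.
have pq := @prox_growth a b p q erefl erefl.
have qp := @prox_growth b a q p erefl erefl; clearbody p q.
have := enorm_four_points p q a b => fp.
rewrite (enorm_distC_sqr q p) in pq.
have : c * (2 * enorm (p - q) ^+ 2) <=
    c * (enorm (p - q) ^+ 2 + enorm (a - b) ^+ 2).
  apply: le_trans (ler_wpM2l (ltW c_gt0) fp); lra.
rewrite ler_pM2l//; lra.
Qed.

End Prox.

(** * The natural residual *)

Section Residual.
Variables (R : realType) (n : nat) (f : 'rV[R]_n -> R).
Variables (g : 'rV[R]_n -> \bar R) (gamma L : R).
Hypotheses (g_proper : proper_efun g) (g_lsc : lower_semicontinuous g).
Hypotheses (g_convex : convex_efun g) (gamma_gt0 : 0 < gamma).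
Hypothesis L_ge0 : 0 <= L.
Hypothesis f_lip : forall y z : 'rV[R]_n,
  enorm (grad f y - grad f z) <= L * enorm (y - z).

Lemma fwd_lipschitz y z : enorm (fwd gamma f y - fwd gamma f z) ^+ 2 <=
  (2 + 2 * (gamma * L) ^+ 2) * enorm (y - z) ^+ 2.
Proof.
have -> : fwd gamma f y - fwd gamma f z =
    (y - z) + (- gamma) *: (grad f y - grad f z).
  by apply/rowP => i; rewrite !mxE; ring.
apply: le_trans (enormD_sqr_le _ _) _; rewrite enormZ_sqr sqrrN.
have : enorm (grad f y - grad f z) ^+ 2 <= (L * enorm (y - z)) ^+ 2.
  by rewrite ler_sqr ?nnegrE ?mulr_ge0// sqrtr_ge0.
move=> /(ler_wpM2l (sqr_ge0 gamma)); rewrite !exprMn; lra.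
Qed.

(** The constant is crude, being obtained from [(s + t)^2 <= 2 s^2 + 2 t^2]
    instead of the triangle inequality; only its finiteness matters. *)
Lemma natres_lipschitz y z :
  enorm (natres gamma f g y - natres gamma f g z) ^+ 2 <=
  gamma^-1 ^+ 2 * (2 + 2 * (2 + 2 * (gamma * L) ^+ 2)) * enorm (y - z) ^+ 2.
Proof.
have -> : natres gamma f g y - natres gamma f g z = gamma^-1 *:
    ((y - z) + - (fwd_bwd gamma f g y - fwd_bwd gamma f g z)).
  by rewrite /natres -scalerBr opprD addrACA -opprD.
rewrite enormZ_sqr -mulrA ler_wpM2l ?sqr_ge0//.
apply: le_trans (enormD_sqr_le _ _) _; rewrite enormN_sqr.
have := prox_nonexpansive g_proper g_lsc g_convex gamma_gt0
  (fwd gamma f y) (fwd gamma f z).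
have := fwd_lipschitz y z; rewrite /fwd_bwd; lra.
Qed.

Lemma natres_limit_eq0 (z : nat -> 'rV[R]_n) zstar :
  z @ \oo --> zstar ->
  (fun k => enorm (natres gamma f g (z k)) ^+ 2) @ \oo --> 0 ->
  natres gamma f g zstar = 0.
Proof.
move=> zz rz; apply: enorm_sqr_eq0.
set C := gamma^-1 ^+ 2 * (2 + 2 * (2 + 2 * (gamma * L) ^+ 2)).
have dz : (fun k => enorm (z k - zstar) ^+ 2) @ \oo --> 0.
  have e0 : enorm (zstar - zstar) ^+ 2 = 0.
    by rewrite subrr enorm_sqr big1// => i _; rewrite mxE expr0n.
  rewrite -e0.
  exact: (continuous_cvg _ (@continuous_enorm_sqr _ _ zstar zstar) zz).
have bz : (fun k => 2 * (C * enorm (z k - zstar) ^+ 2)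
    + 2 * enorm (natres gamma f g (z k)) ^+ 2) @ \oo --> 2 * (C * 0) + 2 * 0.
  exact: (cvgD (cvgM (cvg_cst _) (cvgM (cvg_cst _) dz)) (cvgM (cvg_cst _) rz)).
rewrite !mulr0 addr0 in bz.
apply: (cvgr_to_ge bz); apply: nearW => k.
rewrite -[natres gamma f g zstar](subrK (natres gamma f g (z k))).
apply: le_trans (enormD_sqr_le _ _) _; rewrite lerD2r ler_pM2l//.
by rewrite (enorm_distC_sqr (z k)); exact: natres_lipschitz.
Qed.

End Residual.

(** * Runs of the algorithm *)

Section Run.
Variables (R : realType) (n : nat) (f : 'rV[R]_n -> R).
Variables (g : 'rV[R]_n -> \bar R) (gamma beta sigma : R).
Variables (x xbar xhat d : nat -> 'rV[R]_n) (tau : nat -> R).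
Hypotheses (g_proper : proper_efun g) (g_lsc : lower_semicontinuous g).
Hypotheses (g_convex : convex_efun g) (gamma_gt0 : 0 < gamma).
Hypothesis run : panoc_lite f g gamma beta sigma x xbar xhat d tau.

Let phi k := fine (cost f g (xhat k)).
Let r k := enorm (natres gamma f g (xhat k)) ^+ 2.

(** Real costs are what allows the linesearch inequality, stated with a
    subtraction of extended reals, to be rearranged and telescoped. *)
Lemma panoc_cost_fin k : cost f g (xhat k) = (phi k)%:E.
Proof.
rewrite /phi /cost (panoc_xhat run k).
by have [s ->] := prox_fin g_proper g_lsc g_convex gamma_gt0 (x k).
Qed.

Lemma panoc_descent k : phi k.+1 <= phi k - sigma * r k.
Proof.
have [_] := panoc_tau_accepted run k.
rewrite -(panoc_xbar run) -(panoc_step run) -(panoc_xhat run).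
by rewrite !panoc_cost_fin lee_fin -/(r k); lra.
Qed.

Lemma panoc_sum_le N : phi N + sigma * \sum_(0 <= k < N) r k <= phi 0%N.
Proof.
elim: N => [|N IH]; first by rewrite big_geq// mulr0 addr0.
by rewrite big_nat_recr//= mulrDr; have := panoc_descent N; lra.
Qed.

Hypothesis sigma_gt0 : 0 < sigma.

Lemma panoc_cost_le_initial k : phi k <= phi 0%N.
Proof.
apply: le_trans (panoc_sum_le k); rewrite lerDl mulr_ge0 ?(ltW sigma_gt0)//.
by apply: sumr_ge0 => i _; exact: sqr_ge0.
Qed.

Lemma panoc_summable (m : R) : (forall u, (m%:E <= cost f g u)%E) ->
  (\sum_(0 <= k <oo) (r k)%:E < +oo)%E.
Proof.
move=> mle; have r0 k : 0 <= r k by exact: sqr_ge0.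
apply: (@le_lt_trans _ _ ((phi 0%N - m) / sigma)%:E); last exact: ltry.
apply: lime_le.
  by apply: is_cvg_nneseries => k _ _; rewrite lee_fin.
apply: nearW => N; rewrite sumEFin lee_fin ler_pdivlMr// mulrC.
have := panoc_sum_le N; have := mle (xhat N); rewrite panoc_cost_fin lee_fin.
lra.
Qed.

End Run.

Lemma argmin_cost_lower_bound (R : realType) (n : nat) (f : 'rV[R]_n -> R)
    (g : 'rV[R]_n -> \bar R) :
  proper_efun g -> argmin (cost f g) !=set0 ->
  exists m : R, forall u, (m%:E <= cost f g u)%E.
Proof.
move=> [gNy _] [u umin]; have := gNy u.
case E : (g u) => [s||]// _; last first.
  exists 0 => v; apply: le_trans (umin v).
  by rewrite /cost E leey.
by exists (f u + s) => v; have := umin v; rewrite {1}/cost E.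
Qed.

Theorem theorem9 (R : realType) (n : nat) (f : 'rV[R]_n -> R)
    (g : 'rV[R]_n -> \bar R) (L gamma beta sigma : R)
    (x xbar xhat d : nat -> 'rV[R]_n) (tau : nat -> R)
    (f_diff : forall z : 'rV[R]_n, differentiable f z)
    (L_gt0 : 0 < L)
    (f_lip : forall y z : 'rV[R]_n,
      enorm (grad f y - grad f z) <= L * enorm (y - z))
    (g_proper : proper_efun g)
    (g_lsc : lower_semicontinuous g)
    (g_convex : convex_efun g)
    (argmin_neq0 : argmin (cost f g) !=set0)
    (gamma_gt0 : 0 < gamma) (gamma_lt : gamma < 2 / L)
    (beta_gt0 : 0 < beta) (beta_lt1 : beta < 1)
    (sigma_gt0 : 0 < sigma)
    (sigma_lt : sigma < gamma * ((2 - gamma * L) / 2))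
    (run : panoc_lite f g gamma beta sigma x xbar xhat d tau) :
  [/\ (\sum_(0 <= k <oo) (enorm (natres gamma f g (xhat k)) ^+ 2)%:E < +oo)%E,
      forall xstar : 'rV[R]_n, limit_of_subseq xhat xstar ->
        natres gamma f g xstar = 0
    & level_bounded (cost f g) -> bounded_set (range xhat)].
Proof.
have [m mle] := argmin_cost_lower_bound g_proper argmin_neq0.
have sum_fin :=
  panoc_summable g_proper g_lsc g_convex gamma_gt0 run sigma_gt0 mle.
split=> [//|xstar [s [s_incr sxstar]]|].
- have r_cvg0 :=
    cvg_series_cvg_0 (nnseries_is_cvg (fun k => sqr_ge0 _) sum_fin).
  have s_ge k : (k <= s k)%N.
    elim: k => // k IH; apply: leq_ltn_trans IH _.
    by have := s_incr k.+1 k; rewrite !leEnat ltnn ltnNge => ->.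
  have s_cvgy : s @ \oo --> \oo.
    apply/cvgnyPge => M; near=> k; apply: leq_trans (s_ge k).
    by near: k; exact: nbhs_infty_ge.
  apply: (natres_limit_eq0 g_proper g_lsc g_convex gamma_gt0 (ltW L_gt0) f_lip
    sxstar).
  exact: (cvg_comp _ _ s_cvgy r_cvg0).
- move=> /(_ (fine (cost f g (xhat 0%N)))) [M [Mreal Mbound]].
  exists M; split => // M' MM' _ [k _ <-]; apply: (Mbound _ MM').
  rewrite /= (panoc_cost_fin g_proper g_lsc g_convex gamma_gt0 run) lee_fin.
  exact: (panoc_cost_le_initial g_proper g_lsc g_convex gamma_gt0 run
    sigma_gt0).
Unshelve. all: by end_near. Qed.
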